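(* Let $k,r,m$ be positive integers, $u_i=k+(i-1)r$ for $1\le i\le m$, and fix $p\in[0,1]$. For $\pi\in[u_m]^m$ run the probabilistic parking protocol with parameter $p$ on a street with spots $1,\dots,u_m$, and let $V$ be the event that all $m$ cars park and the occupied spots $s_1<\dots<s_m$ satisfy $s_i\le u_i$ for all $i$. Then $$\sum_{\pi\in[u_m]^m}\mathbb E\big[x^{\mathrm{unl}}\,y^{\mathrm{lel}(\pi)}\,\mathbf 1_V\big]=k\,y\prod_{i=1}^{m-1}\big(xy+(i-1)x+k+mr-i\big).$$
   Context: Probabilistic parking protocol with parameter $p$: cars $1,\dots,m$ arrive in order; a car parks in its preferred spot if unoccupied, otherwise flips an independent coin and with probability $p$ parks in the first unoccupied spot with larger label, with probability $1-p$ in the first unoccupied spot with smaller label, failing to park if there is none in the chosen direction. $\mathrm{unl}$ is the number of cars parking in a spot different from their preference. $\mathrm{lel}(\pi)=\#\{i:\pi_i=\pi_1\}$ (this counts car $1$). *)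

(* Defs.v *)
From mathcomp Require Export all_boot all_order all_algebra.

Set Implicit Arguments.
Unset Strict Implicit.
Unset Printing Implicit Defensive.

Import Order.TTheory GRing.Theory Num.Theory.

(* The arithmetic progression u_i = k + (i - 1) r, for i >= 1. *)
Definition uvec (k r i : nat) : nat := k + i.-1 * r.

(* The street is {1, ..., n}.  [occ] lists the occupied spots; [fwd] is the
   car's coin, which only matters when the preferred spot is taken.  A car sent
   to the left takes the first free spot it meets while backing up, that is the
   largest free label below its preference.  [None] means failure to park. *)
Definition next_spot (n : nat) (occ : seq nat) (pref : nat) (fwd : bool) :
    option nat :=
  if pref \notin occ then Some pref
  else if fwd then ohead [seq s <- iota pref.+1 (n - pref) | s \notin occ]
  else ohead [seq s <- rev (iota 1 pref.-1) | s \notin occ].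

(* The i-th entry of the result is the fate of the i-th car. *)
Fixpoint park_from (n : nat) (occ prefs : seq nat) (coins : seq bool) :
    seq (option nat) :=
  match prefs, coins with
  | pref :: prefs', fwd :: coins' =>
      let s := next_spot n occ pref fwd in
      s :: park_from n (seq_of_opt s ++ occ) prefs' coins'
  | _, _ => [::]
  end.

Definition park (n : nat) (prefs : seq nat) (coins : seq bool) :=
  park_from n [::] prefs coins.

(* Increasing list of the occupied spots. *)
Definition occupied (n : nat) (out : seq (option nat)) : seq nat :=
  [seq s <- iota 1 n | Some s \in out].

Definition unl (prefs : seq nat) (out : seq (option nat)) : nat :=
  count (fun q => if q.2 is Some s then s != q.1 else false) (zip prefs out).

Definition lel (prefs : seq nat) : nat := count_mem (head 0 prefs) prefs.

(* The event V.  Since all cars park, [occupied] has m entries, so the default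
   value of [nth] is never used. *)
Definition all_park_u (k r m : nat) (out : seq (option nat)) : bool :=
  all isSome out &&
  all (fun i => nth 0 (occupied (uvec k r m) out) i.-1 <= uvec k r i)
      (iota 1 m).

(* An element j of 'I_n stands for the spot with label j + 1. *)
Definition labels (m n : nat) (pi : m.-tuple 'I_n) : seq nat :=
  [seq (val j).+1 | j <- pi].

Local Open Scope ring_scope.

(* Expectation over m independent coins with P(true) = p.  One coin is drawn
   for each car; the protocol ignores those of cars that need none. *)
Definition coins_prob (R : pzRingType) (p : R) (m : nat) (c : m.-tuple bool) :
    R :=
  \prod_(b <- c) (if b then p else 1 - p).

Definition expect_coins (R : pzRingType) (p : R) (m : nat)
    (X : m.-tuple bool -> R) : R :=
  \sum_(c : m.-tuple bool) coins_prob p c * X c.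

(* Main.v *)
(** Pollak's circle argument, for one fixed sequence of coins.  Let the cars park
   on the circle Z/N with N = k + m r.  There every car parks, and when i cars
   have parked, the next one contributes x y if it prefers the spot of car 1, x
   if it prefers another of the i occupied spots, and 1 otherwise: a factor
   x y + (i - 1) x + N - i whatever its coin does.  Since r > 0, an outcome with
   s_i <= u_i leaves the spots u_m + 1, ..., N free, so that no car has crossed
   them, and the event V on the line is this condition on the circle.  Both
   statistics are invariant under rotation, and by the cycle lemma exactly k of
   the N rotations of an m-subset of Z/N satisfy s_i <= u_i; hence V accounts for
   the fraction k / N of the total on the circle. *)

Require Import Defs.
From mathcomp Require Import all_boot all_order all_algebra.
From mathcomp Require Import zify ring.
Import Order.TTheory GRing.Theory Num.Theory.
Set Implicit Arguments.
Unset Strict Implicit.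
Unset Printing Implicit Defensive.
Local Open Scope ring_scope.

(** * Sums over tuples and over coins *)

Lemma sum_tuple_cons (V : nmodType) (T : finType) {m : nat} (F : seq T -> V) :
  \sum_(t : m.+1.-tuple T) F t = \sum_(a : T) \sum_(t : m.-tuple T) F (a :: t).
Proof.
rewrite pair_big /= (reindex (fun q : T * m.-tuple T => [tuple of q.1 :: q.2])) //=.
exists (fun t : m.+1.-tuple T => (thead t, [tuple of behead t])).
  by move=> [a t] _; congr pair; apply/val_inj.
by move=> t _; rewrite [RHS]tuple_eta; apply/val_inj.
Qed.

Lemma sum_tuple0 (V : nmodType) (T : finType) (F : seq T -> V) :
  \sum_(t : 0.-tuple T) F t = F [::].
Proof.
rewrite (big_pred1 [tuple]) // => t /=; symmetry; apply/eqP; exact: tuple0.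
Qed.

(** Lets preferences on the street be treated as preferences on the longer circle. *)
Lemma sum_tuple_widen (V : nmodType) (n N m : nat) (F : seq nat -> V) :
  (n <= N)%N ->
  \sum_(t : m.-tuple 'I_n) F [seq (val j).+1 | j <- t] =
  \sum_(t : m.-tuple 'I_N)
    if all (fun j : 'I_N => val j < n)%N t then F [seq (val j).+1 | j <- t] else 0.
Proof.
move=> le_nN; pose lab p (t : seq 'I_p) := [seq (val j).+1 | j <- t].
pose G (t : seq 'I_N) := if all (fun j : 'I_N => val j < n)%N t then F (lab N t) else 0.
rewrite -[RHS]/(\sum_(t : m.-tuple 'I_N) G t).
elim: m F @G => [|m IH] F G.
  by rewrite (sum_tuple0 (fun t => F (lab n t))) sum_tuple0.
rewrite (sum_tuple_cons (fun t => F (lab n t))) sum_tuple_cons.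
under eq_bigr => j _ do rewrite (IH (fun s => F (j.+1 :: s))).
rewrite (big_ord_widen_cond N xpredT (fun j => \sum_(t : m.-tuple 'I_N)
  if all (fun i : 'I_N => val i < n)%N t then F (j.+1 :: lab N t) else 0)) //=.
rewrite big_mkcond /=; apply: eq_bigr => j _; rewrite /G /=.
by case: ifP => // _; rewrite big1.
Qed.

Lemma expect_coins_const (R : comPzRingType) (p : R) (m : nat)
    (X : m.-tuple bool -> R) (a : R) :
  (forall c, X c = a) -> expect_coins p X = a.
Proof.
move=> Xa; rewrite /expect_coins.
under eq_bigr => c _ do rewrite Xa.
rewrite -mulr_suml -[RHS]mul1r; congr (_ * a); rewrite /coins_prob.
elim: m {X Xa} => [|m IH]; first by rewrite (sum_tuple0 (fun c => \prod_(b <- c) _)) big_nil.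
rewrite (sum_tuple_cons (fun c => \prod_(b <- c) _)).
rewrite (eq_bigr (fun b : bool => if b then p else 1 - p)) => [|b _].
  by rewrite big_bool /= addrC subrK.
by under eq_bigr => c _ do rewrite big_cons; rewrite -mulr_sumr IH mulr1.
Qed.

(** * Cycle lemma for a periodic walk *)

Fixpoint running_min (F : nat -> int) (i : nat) : int :=
  if i is i'.+1 then Num.min (running_min F i') (F i) else F 0%N.

Lemma le_running_min (F : nat -> int) (c : int) (i : nat) :
  (forall l, (l <= i)%N -> c <= F l) <-> c <= running_min F i.
Proof.
elim: i => [|i IH] /=.
  by split=> [|h l]; [apply | rewrite leqn0 => /eqP->].
rewrite le_min; split=> [h | /andP[/IH h1 h2] l].
  by rewrite h // andbT; apply/IH => l li; apply/h/leqW.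
by rewrite leq_eqVlt => /orP[/eqP-> // | /h1].
Qed.

(** A step lowers [F] by at most 1, so each new strict record lowers the minimum by exactly 1. *)
Lemma running_min_records (F : nat -> int) (b q : nat) :
  (forall i, F i - 1 <= F i.+1) ->
  running_min F (b + q) =
  running_min F b - (count (fun j => F (b + j).+1 < running_min F (b + j)) (iota 0 q))%:Z.
Proof.
move=> Fstep; elim: q => [|q IH]; first by rewrite addn0 subr0.
rewrite -[X in iota 0 X]addn1 iotaD count_cat /= add0n addnS /= addn0.
have := (le_running_min F (running_min F (b + q)) (b + q)).2 (lexx _) (b + q)%N (leqnn _).
have := Fstep (b + q)%N; rewrite minElt; case: ltP; lia.
Qed.

(* The circ_valid starting points are the strict records of the running minimum of
   the walk with steps [r * e i - 1]; this minimum drops by 1 at each record and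
   by [k] over a period. *)
Lemma cycle_lemma (e : pred nat) (n k r : nat) :
  (forall i, e (i + n)%N = e i) -> n = (k + count e (iota 0 n) * r)%N ->
  count (fun j => all (fun t => t < k + r * count e (iota j t))%N (iota 0 n)) (iota 0 n) = k.
Proof.
move=> eP en; pose F i : int := (r * count e (iota 0 i))%:Z - i%:Z.
have FD i t : F (i + t)%N = F i + (r * count e (iota i t))%:Z - t%:Z.
  by rewrite /F iotaD count_cat add0n; lia.
have cshift i : count e (iota n i) = count e (iota 0 i).
  by rewrite -[n in iota n]addn0 iotaDl count_map; apply: eq_count => l /=; rewrite addnC eP.
have FP i : F (i + n)%N = F i - k%:Z.
  by rewrite addnC FD /F cshift; lia.
have Fstep i : F i - 1 <= F i.+1 by rewrite -addn1 FD; lia.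
case: n => [|n'] in eP en cshift FP *; first by rewrite /=; lia.
(* Records are counted from [n'] on, when a whole period has been seen; index [j] stands for a
   record at [j + n]. *)
have /(_ n'.+1) := running_min_records n' _ Fstep.
have -> : running_min F (n' + n'.+1) = running_min F n' - k%:Z.
  apply/le_anti/andP; split; last first.
    apply/le_running_min => l lle.
    have h := (le_running_min F (running_min F n') n').2 (lexx _).
    have [ln|ln] := leqP l n'; first by have := h _ ln; lia.
    by have := h (l - n'.+1)%N; rewrite -{3}(subnK ln) FP; lia.
  rewrite lerBrDr; apply/le_running_min => l ln.
  have /(_ (l + n'.+1)%N) := (le_running_min F _ (n' + n'.+1)).2 (lexx _).
  by rewrite FP; lia.
move=> h.
transitivity (count (fun j => F (n' + j).+1 < running_min F (n' + j)) (iota 0 n'.+1)); last by lia.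
apply: eq_in_count => j; rewrite mem_iota add0n => jn.
(* Since [F (j + n) = F j - k], the condition at [j] says that [F (j + n) < F l] for
   [j <= l < j + n]. An earlier [l] is compared through [l + n], as [F] does not increase over a
   period. *)
apply/allP/idP => [hv | hm t].
  rewrite -lez1D; apply/le_running_min => l ln.
  have valid_gt l' : (j <= l' < j + n'.+1)%N -> F (j + n'.+1)%N < F l'.
    move=> /andP[jl lj]; have /hv : (l' - j)%N \in iota 0 n'.+1 by rewrite mem_iota; lia.
    by rewrite -{3}(subnKC jl) FP FD; lia.
  have -> : (n' + j).+1 = (j + n'.+1)%N by lia.
  have [jl|lj] := leqP j l; first by have := valid_gt l; lia.
  by have := valid_gt (l + n'.+1)%N; rewrite (FP l); lia.
rewrite mem_iota => tn.
have := (le_running_min F _ (n' + j)).2 (lexx _) (j + t)%N.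
by move: hm; rewrite (_ : (n' + j).+1 = j + n'.+1)%N ?FP ?FD; lia.
Qed.

(** * Entries of filtered lists *)

(** Used to trade bounds on the i-th occupied spot for bounds on counts of occupied spots. *)
Lemma count_before_nth_filter (P : pred nat) (a n c : nat) :
  (c < size (filter P (iota a n)))%N ->
  let s := nth 0%N (filter P (iota a n)) c in
  [/\ (a <= s)%N, P s & count P (iota a (s - a)) = c].
Proof.
elim: n a c => [|n IH] a c //=; case: ifP => Pa.
  case: c => [_|c /= /IH[]]; first by rewrite /= subnn.
  set s := nth _ _ _ => as1 Ps <-; split=> //; first exact: ltnW.
  by rewrite (_ : s - a = (s - a.+1).+1)%N /= ?Pa //; lia.
move=> /IH[]; set s := nth _ _ _ => as1 Ps <-; split=> //; first exact: ltnW.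
by rewrite (_ : s - a = (s - a.+1).+1)%N /= ?Pa //; lia.
Qed.

Lemma head_filter_cat (S : Type) (P : pred S) (s1 s2 : seq S) (b x0 : S) :
  P b -> head x0 (filter P (s1 ++ b :: s2)) = odflt b (ohead (filter P s1)).
Proof. by move=> Pb; rewrite filter_cat /= Pb; case: filter. Qed.

(** * Parking on the circle and its rotations *)

Section Circle.

Variable N0 : nat.
Notation N := N0.+2.
Notation T := 'I_N0.+2.
Implicit Types (occ prefs out : seq T) (a b j : T) (coins : seq bool).

Definition scan a (fwd : bool) (i : nat) : T := if fwd then a + i%:R else a - i%:R.

(** Position 0 of the scan is the preference itself, so a free preferred spot obeys the same rule.
    The default [a] is reached only on a full circle. *)
Definition circ_next occ a (fwd : bool) : T :=
  head a [seq s <- map (scan a fwd) (iota 0 N) | s \notin occ].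

Fixpoint circ_park occ prefs coins : seq T :=
  match prefs, coins with
  | a :: prefs', fwd :: coins' =>
      let s := circ_next occ a fwd in s :: circ_park (s :: occ) prefs' coins'
  | _, _ => [::]
  end.

Definition circ_unl prefs out : nat := count (fun q => q.2 != q.1) (zip prefs out).

Lemma circ_next_free occ a fwd : a \notin occ -> circ_next occ a fwd = a.
Proof. by move=> aN; rewrite /circ_next /= /scan subr0 addr0 if_same aN. Qed.

Lemma val_natZp (i : nat) : val (i%:R : T) = (i %% N)%N.
Proof. by rewrite Zp_nat. Qed.

Lemma natZp_val a : (val a)%:R = a.
Proof. by apply/val_inj; rewrite val_natZp modn_small ?ltn_ord. Qed.

Lemma scan_surj a fwd b : b \in map (scan a fwd) (iota 0 N).
Proof.
pose d := if fwd then b - a else a - b.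
apply/mapP; exists (val d); first by rewrite mem_iota ltn_ord.
rewrite /scan natZp_val {}/d; case: fwd; last by rewrite subKr.
by rewrite addrC subrK.
Qed.

Lemma head_filter (S : eqType) (s : seq S) (P : pred S) x0 :
  has P s -> P (head x0 (filter P s)).
Proof. by elim: s => //= x s IH; case: ifP. Qed.

Lemma circ_next_notin occ a fwd : (size occ < N)%N -> circ_next occ a fwd \notin occ.
Proof.
move=> lt_occ; apply: (@head_filter _ _ (fun s => s \notin occ)).
have [b bN] : exists b, b \notin occ.
  apply/existsP; rewrite -negb_forall; apply/negP => /forallP all_occ.
  have le_T : (#|T| <= #|occ|)%N by apply/subset_leq_card/subsetP => b _; exact: all_occ.
  by have := leq_trans le_T (card_size _); rewrite card_ord leqNgt lt_occ.
by apply/hasP; exists b => //; exact: scan_surj.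
Qed.

Lemma circ_park_uniq occ prefs coins :
  uniq occ -> (size occ + size prefs <= N)%N -> size coins = size prefs ->
  uniq (circ_park occ prefs coins ++ occ) /\ size (circ_park occ prefs coins) = size prefs.
Proof.
elim: prefs occ coins => [|a prefs IH] occ [|fwd coins] //= uocc lesz [eqsz].
have uocc' : uniq (circ_next occ a fwd :: occ).
  by rewrite /= uocc circ_next_notin //; lia.
have [|u ->] := IH _ _ uocc' _ eqsz; first by rewrite /=; lia.
by split=> //; move: u; rewrite -(cat1s _ occ) uniq_catCA.
Qed.

Lemma circ_next_shift j occ a fwd :
  circ_next (map (+%R^~ j) occ) (a + j) fwd = circ_next occ a fwd + j.
Proof.
rewrite /circ_next.
have -> : map (scan (a + j) fwd) (iota 0 N) = map (+%R^~ j) (map (scan a fwd) (iota 0 N)).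
  by rewrite -map_comp; apply: eq_map => i; rewrite /= /scan; case: fwd; rewrite addrAC.
rewrite filter_map (eq_filter (a2 := fun s => s \notin occ)).
  by case: filter.
by move=> s /=; rewrite (mem_map (addIr j)).
Qed.

Lemma circ_park_shift j occ prefs coins :
  circ_park (map (+%R^~ j) occ) (map (+%R^~ j) prefs) coins =
  map (+%R^~ j) (circ_park occ prefs coins).
Proof.
elim: prefs occ coins => [|a prefs IH] occ [|fwd coins] //=.
by rewrite circ_next_shift -IH.
Qed.

Lemma circ_unl_shift j prefs out :
  circ_unl (map (+%R^~ j) prefs) (map (+%R^~ j) out) = circ_unl prefs out.
Proof.
rewrite /circ_unl; elim: prefs out => [|a prefs IH] [|b out] //=.
by rewrite IH (inj_eq (addIr j)).
Qed.

(** * Generating function of all preferences on the circle *)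

Lemma sum_one_car (R : comPzRingType) (x y : R) occ b :
  uniq occ -> b \in occ ->
  \sum_(a : T) x ^+ (a \in occ) * y ^+ (a == b) =
  x * y + ((size occ)%:R - 1) * x + (N%:R - (size occ)%:R).
Proof.
move=> uocc bocc.
rewrite (bigID (mem occ)) /= (bigD1 b) //= bocc eqxx; congr (_ + _ + _).
  rewrite (eq_bigr (fun=> x)) => [|a /andP[ao /negPf ab]]; last by rewrite ao ab mulr1.
  rewrite sumr_const -[in RHS](card_uniqP uocc) [in RHS](cardD1 b) bocc add1n -natr1 addrK.
  by rewrite mulr_natl; congr (_ *+ _); apply: eq_card => a; rewrite !inE andbC.
rewrite (eq_bigr (fun=> 1)) => [|a aN]; last first.
  by rewrite (negPf aN) (_ : a == b = false) ?mulr1 //; apply: contraNF aN => /eqP->.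
have -> : N%:R = (size occ)%:R + #|[predC occ]|%:R :> R.
  by rewrite -natrD -(card_uniqP uocc) cardC card_ord.
by rewrite sumr_const addrC addrA addNr add0r.
Qed.

(* Once [b], the spot of the first car, is occupied, each preference for [b]
   displaces the car and counts for lel. *)
Lemma circ_gf_from (R : comPzRingType) (x y : R) occ b coins :
  uniq occ -> b \in occ -> (size occ + size coins <= N)%N ->
  \sum_(t : (size coins).-tuple T)
     x ^+ circ_unl t (circ_park occ t coins) * y ^+ count_mem b t =
  \prod_(size occ <= i < size occ + size coins)
     (x * y + (i%:R - 1) * x + (N%:R - i%:R)).
Proof.
elim: coins occ => [|fwd coins IH] occ uocc bocc lesz.
  rewrite (sum_tuple0 (fun t => x ^+ circ_unl t (circ_park occ t [::]) * y ^+ count_mem b t)).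
  by rewrite /= addn0 big_geq // mulr1.
rewrite (sum_tuple_cons (fun t =>
  x ^+ circ_unl t (circ_park occ t (fwd :: coins)) * y ^+ count_mem b t)).
rewrite big_ltn /=; last by lia.
rewrite -(sum_one_car _ _ uocc bocc) mulr_suml; apply: eq_bigr => a _.
have socc : (size occ < N)%N by rewrite /= in lesz; lia.
have := IH (circ_next occ a fwd :: occ).
rewrite /= circ_next_notin // inE bocc orbT uocc -addSnnS => <- //; last by rewrite /= in lesz; lia.
rewrite mulr_sumr; apply: eq_bigr => t _.
have -> : circ_unl (a :: t) (circ_next occ a fwd :: circ_park (circ_next occ a fwd :: occ) t coins) =
   ((a \in occ) + circ_unl t (circ_park (circ_next occ a fwd :: occ) t coins))%N.
  rewrite /circ_unl /=; congr (_ + _)%N.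
  case: (boolP (a \in occ)) => ao; last by rewrite circ_next_free ?eqxx.
  by case: eqP => // eq_a; have := circ_next_notin a fwd socc; rewrite eq_a ao.
by rewrite !exprD; ring.
Qed.

Lemma circ_gf (R : comPzRingType) (x y : R) (m : nat) coins :
  size coins = m -> (0 < m <= N)%N ->
  \sum_(t : m.-tuple T)
     x ^+ circ_unl t (circ_park [::] t coins) * y ^+ count_mem (head 0 t) t =
  N%:R * y * \prod_(1 <= i < m) (x * y + (i%:R - 1) * x + (N%:R - i%:R)).
Proof.
case: coins => [<- //|fwd coins] <- /= lesz.
rewrite (sum_tuple_cons (fun t => x ^+ circ_unl t (circ_park [::] t (fwd :: coins))
  * y ^+ count_mem (head 0 t) t)) /=.
rewrite (eq_bigr (fun=> y * \prod_(1 <= i < (size coins).+1)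
   (x * y + (i%:R - 1) * x + (N%:R - i%:R)))) => [|a _].
  by rewrite sumr_const card_ord -[LHS]mulr_natl mulrA.
have := @circ_gf_from _ x y [:: a] a coins isT.
rewrite inE eqxx add1n => <- //.
rewrite mulr_sumr; apply: eq_bigr => t _.
by rewrite circ_next_free // /circ_unl /= eqxx add0n exprS; ring.
Qed.

(** * Valid outcomes and their rotations *)

(* The circle is cut just before spot 0.  For [size out] cars and
   [N = k + size out * r], positivity of [k + r * #{s in out | s < t} - t] for
   all [t < N] says exactly that the i-th smallest label is at most
   [k + (i - 1) * r]. *)
Definition circ_valid (k r : nat) out : bool :=
  all (fun t => t < k + r * count (fun i => (i%:R : T) \in out) (iota 0 t))%N (iota 0 N).

Lemma count_occupied out : uniq out ->
  count (fun i => (i%:R : T) \in out) (iota 0 N) = size out.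
Proof.
move=> uout; rewrite -val_enum_ord count_map -(card_uniqP uout) cardE size_filter enumT.
by apply: eq_count => a /=; rewrite natZp_val.
Qed.

Lemma circ_valid_rotations (k r : nat) out :
  uniq out -> N = (k + size out * r)%N ->
  (\sum_(j : T) circ_valid k r (map (+%R^~ j) out) = k)%N.
Proof.
move=> uout eN.
(* Rotating by [- j] brings spot [j] to the cut, so rotations correspond to the starting points [j]
   of the cycle lemma. *)
rewrite (reindex_inj (@oppr_inj T)) /=.
rewrite -[RHS](@cycle_lemma (fun i => (i%:R : T) \in out) N k r); first last.
- by rewrite count_occupied.
- by move=> i; rewrite natrD -[N%:R]natZp_val val_natZp modnn addr0.
pose v (l : nat) :=
  all (fun t => t < k + r * count (fun i => (i%:R : T) \in out) (iota l t))%N (iota 0 N).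
rewrite -[RHS]/(count v (iota 0 N)) -val_enum_ord count_map -sum1_count.
rewrite [RHS]big_mkcond [RHS]big_enum; apply: eq_bigr => j _.
rewrite -[LHS]/(if circ_valid k r (map (+%R^~ (- j)) out) then 1%N else 0%N).
congr (if _ then _ else _); apply: eq_all => t; congr (_ < _ + _ * _)%N.
rewrite -[X in _ = count _ (iota X t)]addn0 iotaDl count_map; apply: eq_count => i /=.
by rewrite natrD natZp_val -{1}[i%:R](addKr j) addrC (mem_map (addIr _)).
Qed.

(** * Comparison of the line with the circle *)

Definition label a : nat := (val a).+1.

Lemma label_inj : injective label.
Proof. by move=> a b [/val_inj]. Qed.

Lemma map_scan_fwd n a : (val a < n <= N)%N ->
  map label (map (scan a true) (iota 1 (n - (val a).+1))) = iota (val a).+2 (n - (val a).+1).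
Proof.
move=> /andP[an nN]; rewrite -map_comp -[in RHS](addn1 (val a).+1) iotaDl.
apply/eq_in_map => i; rewrite mem_iota => ilt /=.
rewrite /label /scan -{1}[a]natZp_val -natrD val_natZp modn_small ?addSn //; lia.
Qed.

Lemma map_scan_bwd a : map label (map (scan a false) (iota 1 (val a))) = rev (iota 1 (val a)).
Proof.
apply: (@eq_from_nth _ 0%N) => [|i]; rewrite !size_map size_iota ?size_rev ?size_iota // => ilt.
rewrite -map_comp (nth_map 0%N) ?size_iota // nth_rev ?size_iota // !nth_iota //; last by lia.
have aN : (val a < N)%N := ltn_ord a.
rewrite /comp /label /scan -{1}[a]natZp_val -natrB; last by lia.
by rewrite val_natZp modn_small ?size_iota; lia.
Qed.

(** The first step off the street leads to spot [n] going forward and to spot [N - 1] going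
    backward. *)
Lemma val_scan_out n a fwd : (val a < n < N)%N ->
  (n <= val (scan a fwd (if fwd then n - (val a).+1 else val a).+1))%N.
Proof.
move=> /andP[an nN]; rewrite /scan; case: fwd.
  by rewrite -{1}[a]natZp_val -natrD val_natZp modn_small; lia.
rewrite -natr1 natZp_val opprD addNKr.
by rewrite [val _]/= !modn_small; lia.
Qed.

(** From a taken preference, the first [d] steps on the circle visit the spots that the line offers
    in the direction of the coin, in the same order. Step [d.+1] leaves the street for a spot that
    is free, since [occ] lies below [n]. So the car leaves the street exactly when it fails on the
    line. *)
Lemma next_spot_circ_next n occ a fwd :
  (n < N)%N -> all (fun s => val s < n)%N occ -> (val a < n)%N ->
  next_spot n (map label occ) (label a) fwd =
  if (val (circ_next occ a fwd) < n)%N then Some (label (circ_next occ a fwd)) else None.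
Proof.
move=> nN occn an; rewrite /next_spot (mem_map label_inj).
case: (boolP (a \in occ)) => aocc /=; last by rewrite circ_next_free // an.
set d := (if fwd then n - (val a).+1 else val a)%N.
have dN : (d < N0.+1)%N by rewrite {}/d; have : (val a < N)%N := ltn_ord a; case: fwd; lia.
have ns : (n <= val (scan a fwd d.+1))%N by apply: val_scan_out; rewrite an.
have elin : (if fwd then [seq s <- iota (label a).+1 (n - label a) | s \notin map label occ]
    else [seq s <- rev (iota 1 (label a).-1) | s \notin map label occ]) =
    map label [seq s <- map (scan a fwd) (iota 1 d) | s \notin occ].
  rewrite -(eq_filter (a1 := fun s => label s \notin map label occ)); last first.
    by move=> s /=; rewrite (mem_map label_inj).
  rewrite -(@filter_map _ _ label (fun s => s \notin map label occ)) /d.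
  case: fwd {d ns dN}; last by rewrite map_scan_bwd.
  by rewrite map_scan_fwd // an ltnW.
have ecn : circ_next occ a fwd = odflt (scan a fwd d.+1)
    (ohead [seq s <- map (scan a fwd) (iota 1 d) | s \notin occ]).
  have scan0 : scan a fwd 0 = a by rewrite /scan subr0 addr0 if_same.
  have eI : iota 0 N = 0%N :: iota 1 d ++ d.+1 :: iota d.+2 (N0 - d).
    have -> : N = (1 + (d + (1 + (N0 - d))))%N by lia.
    by rewrite !iotaD /= !add1n !addn1.
  rewrite /circ_next eI map_cons [filter _ _]/= scan0 aocc /= map_cat head_filter_cat //.
  by apply/negP => /(allP occn); rewrite ltnNge ns.
have lt_scan : all (fun s => val s < n)%N [seq s <- map (scan a fwd) (iota 1 d) | s \notin occ].
  apply/allP => s /(map_f label); rewrite -[(val s < n)%N]/(label s <= n)%N -elin.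
  move: {s} (label s) => s; rewrite /label.
  by case: fwd {d ns dN elin ecn}; rewrite mem_filter ?mem_rev mem_iota => /andP[_]; lia.
rewrite (_ : (if fwd then _ else _) =
    ohead (map label [seq s <- map (scan a fwd) (iota 1 d) | s \notin occ])); last first.
  by rewrite -elin; case: fwd {d ns dN elin ecn lt_scan}.
rewrite {}ecn; case: filter lt_scan => [_|s l /andP[-> _]] //=.
by rewrite ltnNge ns.
Qed.

(* Spots [n], ..., [N - 1] of the circle are initially free, so a car that fails
   on the line is one that takes such a spot on the circle. *)
Lemma park_from_circ_park n occ prefs coins :
  (n < N)%N -> all (fun s => val s < n)%N occ -> size coins = size prefs ->
  let L := park_from n (map label occ) (map label prefs) coins in
  let out := circ_park occ prefs coins in
  all (fun s => val s < n)%N out = all (fun s => val s < n)%N prefs && all isSome L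
  /\ (all (fun s => val s < n)%N out -> L = [seq Some (label s) | s <- out]).
Proof.
move=> nN; elim: prefs occ coins => [|a prefs IH] occ [|fwd coins] // occn [szc].
rewrite [map label (a :: _)]/= [park_from _ _ _ _]/= [circ_park _ _ _]/=.
have [an|na] := ltnP (val a) n; last first.
  rewrite circ_next_free /= ?[(_ < n)%N]ltnNge ?na //.
  by apply/negP => /(allP occn); rewrite ltnNge na.
rewrite next_spot_circ_next //; case: (ltnP _ n) => [sn|ns] /=; last first.
  by rewrite an ltnNge ns andbF.
have [|h1 h2] := IH (circ_next occ a fwd :: occ) coins _ szc; first by rewrite /= sn.
by rewrite an sn /= h1; split=> // h; rewrite -h2 // h1.
Qed.

(** At most [m - 1] cars are parked before an occupied spot [s], so the condition at [t = s] gives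
    [s < k + (m - 1) * r]. *)
Lemma circ_valid_lt (k r m : nat) out :
  uniq out -> size out = m -> (0 < m)%N -> (0 < r)%N -> N = (k + m * r)%N ->
  circ_valid k r out -> all (fun s => val s < uvec k r m)%N out.
Proof.
move=> uout szo m0 r0 eN /allP hv; apply/allP => s so; rewrite ltnNge; apply/negP => ns.
have /hv : val s \in iota 0 N by rewrite mem_iota ltn_ord.
apply/negP; rewrite -leqNgt; apply: leq_trans ns; rewrite /uvec leq_add2l mulnC leq_mul2r.
apply/orP; right; rewrite -szo -(count_occupied uout).
have sN : (val s < N)%N := ltn_ord s.
have := iotaD 0 (val s) (N - val s); rewrite (subnKC (ltnW sN)) => ->.
rewrite count_cat; set c := count _ (iota (0 + _) _).
suff : (0 < c)%N by lia.
rewrite -has_count; apply/hasP; exists (val s); last by rewrite natZp_val.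
by rewrite mem_iota; lia.
Qed.

Lemma all_park_u_circ_valid (k r m : nat) out :
  uniq out -> size out = m -> (0 < m)%N -> (0 < r)%N -> N = (k + m * r)%N ->
  all (fun s => val s < uvec k r m)%N out ->
  all_park_u k r m [seq Some (label s) | s <- out] = circ_valid k r out.
Proof.
move=> uout szo m0 r0 eN lto; set n := uvec k r m in lto *.
have nN : (n < N)%N by rewrite eN /n /uvec; nia.
(* Labels start at 1 on the line and at 0 on the circle. *)
pose e t := (t.-1%:R : T) \in out.
have occE : occupied n [seq Some (label s) | s <- out] = filter e (iota 1 n).
  apply: eq_in_filter => -[|t]; rewrite mem_iota // => tn.
  have -> : Some t.+1 = Some (label t%:R) by rewrite /label val_natZp modn_small //; lia.
  by rewrite (mem_map (f := fun s => Some (label s))) // => a b [/val_inj].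
have cE t : count (fun i => (i%:R : T) \in out) (iota 0 t) = count e (iota 1 t).
  by rewrite -[X in _ = count _ (iota X t)](addn0 1%N) iotaDl count_map; apply: eq_count => i.
have szf : size (filter e (iota 1 n)) = m.
  rewrite size_filter -cE -szo -(count_occupied uout).
  have := iotaD 0 n (N - n); rewrite (subnKC (ltnW nN)) => ->.
  rewrite count_cat add0n [X in (_ + X)%N](_ : _ = 0%N) ?addn0 //.
  apply/eqP; rewrite -leqn0 leqNgt -has_count; apply/hasP => -[i].
  rewrite mem_iota (subnKC (ltnW nN)) => /andP[ni iN] /(allP lto).
  by rewrite val_natZp modn_small // ltnNge ni.
rewrite /all_park_u occE all_map [all _ out](_ : _ = true) /=; last by apply/allP.
rewrite -/n; apply/allP/allP => h => [t|i]; rewrite mem_iota.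
  rewrite add0n => tN; rewrite cE.
  (* With [c] labels occupied up to [t]: if [c = m], the bound is [t < N]; otherwise the next
     occupied label [s] exceeds [t] and is at most [k + c * r]. *)
  have [lc|gc] := ltnP (count e (iota 1 t)) m; last by nia.
  have /h : (count e (iota 1 t)).+1 \in iota 1 m by rewrite mem_iota; lia.
  have := @count_before_nth_filter e 1 n (count e (iota 1 t)); rewrite szf => /(_ lc).
  rewrite /uvec /=; set s := nth _ _ _ => -[s0 es ec] sle.
  suff : (t < s)%N by nia.
  rewrite ltnNge; apply/negP => st; move: ec; apply/eqP; rewrite ltn_eqF //.
  have := iotaD 1 (s - 1) (t - (s - 1)); rewrite subnKC; last by lia.
  move=> ->; rewrite count_cat -[X in (X < _)%N]addn0 ltn_add2l -has_count.
  by apply/hasP; exists s => //; rewrite mem_iota; lia.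
move=> im; have ic : (i.-1 < m)%N by lia.
have := @count_before_nth_filter e 1 n i.-1.
have := mem_nth 0%N (s := filter e (iota 1 n)) (n := i.-1).
rewrite szf /uvec => /(_ ic) + /(_ ic); set s := nth _ _ _.
rewrite mem_filter mem_iota => sn [s0 _ ec].
(* Exactly [i - 1] occupied labels precede [s], so the condition at [t = s - 1] reads
   [s - 1 < k + r * (i - 1)]. *)
have /h : (s - 1)%N \in iota 0 N by rewrite mem_iota; lia.
by rewrite cE ec; lia.
Qed.

(** * Averaging over rotations *)

Lemma circ_valid_gf (R : numFieldType) (x y : R) (k r m : nat) coins :
  (0 < m)%N -> (0 < r)%N -> N = (k + m * r)%N -> size coins = m ->
  \sum_(t : m.-tuple T)
     x ^+ circ_unl t (circ_park [::] t coins) * y ^+ count_mem (head 0 t) t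
       * (circ_valid k r (circ_park [::] t coins))%:R =
  k%:R * y * \prod_(1 <= i < m) (x * y + (i%:R - 1) * x + (N%:R - i%:R)).
Proof.
move=> m0 r0 eN szc.
have mN : (m <= N)%N by rewrite eN; nia.
pose W (t : seq T) := x ^+ circ_unl t (circ_park [::] t coins) * y ^+ count_mem (head 0 t) t.
pose v (t : seq T) : R := (circ_valid k r (circ_park [::] t coins))%:R.
have WJ j (t : m.-tuple T) : W (map (+%R^~ j) t) = W t.
  rewrite /W -[[::]]/(map (+%R^~ j) [::]) circ_park_shift circ_unl_shift; congr (_ * _ ^+ _).
  case: t => -[|a t] //= _; rewrite !eqxx count_map; congr (_ + _)%N.
  by apply: eq_count => b; rewrite /= (inj_eq (addIr j)).
have vJ (t : m.-tuple T) : \sum_(j : T) v (map (+%R^~ j) t) = k%:R.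
  have [] := @circ_park_uniq [::] t coins isT; rewrite ?size_tuple //.
  rewrite cats0 => ut szt.
  rewrite -[in RHS](@circ_valid_rotations k r _ ut) ?szt // natr_sum.
  by apply: eq_bigr => j _; rewrite /v -[[::]]/(map (+%R^~ j) [::]) circ_park_shift.
have N0R : N%:R != 0 :> R by rewrite pnatr_eq0.
apply: (mulfI N0R); rewrite mulrCA -!mulrA mulrCA.
(* Rotating all preferences by [j] permutes the tuples, so each of the [N] values of [j] gives the
   same sum. After exchanging the sums, [W] is constant along the rotations of a tuple and [v] adds
   up to [k]. *)
transitivity (\sum_(j : T) \sum_(t : m.-tuple T)
  W (map (+%R^~ j) t) * v (map (+%R^~ j) t)).
  set S := (X in _ * X = _); rewrite [RHS](eq_bigr (fun=> S)) => [|j _].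
    by rewrite sumr_const card_ord mulr_natl.
  rewrite /S [RHS](reindex_inj (h := fun t : m.-tuple T => [tuple of map (+%R^~ j) t])) //.
  by move=> t u /(congr1 val) /= /(inj_map (addIr j)) /val_inj.
rewrite exchange_big /=.
under eq_bigr => t _ do under eq_bigr => j _ do rewrite WJ.
under eq_bigr => t _ do rewrite -mulr_sumr vJ.
rewrite -mulr_suml (@circ_gf _ x y m coins) ?m0 //.
by ring.
Qed.

End Circle.

(** * Expectation over the coins and transfer to the circle *)

Theorem theorem3p7 (R : realFieldType) (k r m : nat) (p x y : R)
    (hk : (0 < k)%N) (hr : (0 < r)%N) (hm : (0 < m)%N) (hp : 0 <= p <= 1) :
  \sum_(pi : m.-tuple 'I_(uvec k r m))
     expect_coins p (fun c : m.-tuple bool =>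
       let out := park (uvec k r m) (labels pi) c in
       x ^+ unl (labels pi) out * y ^+ lel (labels pi)
         * (all_park_u k r m out)%:R)
  = k%:R * y
    * \prod_(1 <= i < m)
        (x * y + (i%:R - 1) * x + k%:R + m%:R * r%:R - i%:R).
Proof.
(* For each fixed coin sequence the sum over preferences has the same value, so the expectation is
   that of a constant. *)
rewrite exchange_big /=.
under eq_bigr => c _ do rewrite -mulr_sumr.
apply: expect_coins_const => c.
(* Positivity makes [k + m * r] at least 2, as the ring structure on ['I_N0.+2] requires. *)
have [N0 eN] : exists N0, N0.+2 = (k + m * r)%N by exists (k + m * r).-2; nia.
set n := uvec k r m.
have nN : (n < N0.+2)%N by rewrite eN /n /uvec; nia.
pose G (s : seq nat) :=
  x ^+ unl s (park n s c) * y ^+ lel s * (all_park_u k r m (park n s c))%:R.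
rewrite (sum_tuple_widen m G (ltnW nN)).
transitivity (k%:R * y * \prod_(1 <= i < m)
  (x * y + (i%:R - 1) * x + (N0.+2%:R - i%:R))); last first.
  congr (_ * _); apply: eq_bigr => i _.
  by rewrite eN natrD natrM !addrA.
rewrite -(@circ_valid_gf N0 R x y k r m c) ?size_tuple //.
apply: eq_bigr => t _; rewrite {}/G.
rewrite -[park _ _ _]/(park_from n (map (@label N0) [::]) (map (@label N0) t) c).
have [] := @circ_park_uniq N0 [::] t c isT; rewrite ?size_tuple //=; first by nia.
rewrite cats0; set out := circ_park _ _ _ => uout szo.
have [] := @park_from_circ_park N0 n [::] t c nN isT; rewrite ?size_tuple // -/out.
set L := park_from _ _ _ _ => eall eL.
have vlt := @circ_valid_lt N0 k r m out uout szo hm hr eN.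
(* If some car parks at [n] or beyond on the circle, both sides vanish: the outcome is not valid
   there, and on the line a preference is off the street or a car fails. *)
have [lto | nlto] := boolP (all (fun s : 'I_N0.+2 => val s < n)%N out); last first.
  rewrite (contraNF vlt nlto) mulr0; case: ifP => // ltt.
  rewrite /all_park_u (_ : all isSome _ = false) ?mulr0 //.
  by move: eall; rewrite ltt (negPf nlto).
rewrite lto in eall; case/esym/andP: eall => -> _.
rewrite (eL lto) all_park_u_circ_valid //.
congr (_ ^+ _ * _ ^+ _ * _).
  rewrite /unl /circ_unl; elim: {+}(tval t) (out) => [|a s IH] [|b o] //=.
  by rewrite IH (inj_eq (@label_inj N0)).
rewrite /lel; case: (tval t) => [|a s] //=; rewrite !eqxx count_map; congr (_ + _)%N.
Qed.
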